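(* For all $n\ge 3$ and all $(i,j)$ with $2\le i<j\le n$ and $j>i+1$, $$\begin{aligned} B_n\,P\big((i,j)\in\mathcal V_n\big)&=\sum_{t=1}^{i-1}S_{i-1,t}\,\Theta_{n-j+1}(t)\,\Psi_{j-i}(t-1)\\ &\quad+\sum_{t=1}^{i-1}S_{i-1,t}\,\Theta_{n-j}(t)\sum_{a=1}^{t}\big\{-a(a-1)^{j-i-1}+\Psi_{j-i}(a-1)\big\}\\ &\quad+\sum_{t=1}^{i-1}S_{i-1,t}\,\Theta_{n-j+1}(t+1)\,t^{j-i-1}\\ &\quad+\sum_{t=1}^{i-1}S_{i-1,t}\,\Theta_{n-j}(t+1)\big\{-(t+1)t^{j-i-1}+\Psi_{j-i}(t)\big\}. \end{aligned}$$
   Context: A restricted growth sequence of length $n$ is a sequence $\pi=\pi_1\cdots\pi_n$ of positive integers with $\pi_1=1$ and $\pi_{j+1}\le 1+\max\{\pi_1,\dots,\pi_j\}$ for $1\le j<n$. $\mathcal R_n$ is the set of all of them; its cardinality is the Bell number $B_n$. $\pi^{(n)}$ denotes a uniformly random element of $\mathcal R_n$. For a sequence $\pi$, $\mathcal V_\pi$ is the set of strong visible pairs: pairs $(i,j)$, $1\le i<j\le n$, with $\max_{i<\ell<j}\pi_\ell<\min\{\pi_i,\pi_j\}$ (with $\max\emptyset=-\infty$). Write $\mathcal V_n:=\mathcal V_{\pi^{(n)}}$; this is the edge set of the horizontal visibility graph of $\pi^{(n)}$. $S_{n,k}$ are the Stirling numbers of the second kind and $B_n=\sum_{k=0}^n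 S_{n,k}$ the Bell numbers. For integers $n,t\ge0$, $$\Theta_n(t):=\frac1e\sum_{m=t}^\infty\frac{m^n}{(m-t)!}=\sum_{\ell=0}^n\binom n\ell t^{n-\ell}B_\ell .$$ For $n\in\mathbb N$, $t\ge0$, $\Psi_n(t):=\sum_{k=0}^t k^{n-1}$; for $n\ge2$ (the only case used) this equals $\frac1n\sum_{\ell=0}^{n-1}\binom n\ell t^{n-\ell}\mathscr B_\ell$, where $\mathscr B_\ell$ are the Bernoulli numbers with the convention $\mathscr B_1=+\tfrac12$. *)

(* Defs.v *)
From HB Require Import structures.
From mathcomp Require Import all_boot all_order all_algebra.
From mathcomp Require Import reals topology normedtype sequences exp.
Set Implicit Arguments.
Unset Strict Implicit.
Unset Printing Implicit Defensive.
Import Order.TTheory GRing.Theory Num.Theory.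
Import numFieldNormedType.Exports.

Local Open Scope nat_scope.

(* Positions in a sequence are numbered from 1. *)
Definition entry (s : seq nat) (j : nat) : nat := nth 0 s j.-1.

Definition restricted_growth (s : seq nat) : bool :=
  [&& all (fun x => 1 <= x) s, entry s 1 == 1 &
      all (fun j => entry s j.+1 <= 1 + \max_(1 <= k < j.+1) entry s k)
          (index_iota 1 (size s))].

(* The entries of a restricted growth sequence of length n are at most n, so
   storing them in 'I_n.+1 loses nothing: see rgsP below. *)
Definition entries n (p : n.-tuple 'I_n.+1) : seq nat := [seq val x | x <- p].

Definition rgs (n : nat) : {set n.-tuple 'I_n.+1} :=
  [set p | restricted_growth (entries p)].

(* Requiring every intermediate entry to be below the minimum agrees with the
   convention that the maximum of the empty set is -oo. *)
Definition strong_visible (s : seq nat) : pred (nat * nat) :=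
  [pred p | [&& 1 <= p.1, p.1 < p.2, p.2 <= size s &
     all (fun l => entry s l < minn (entry s p.1) (entry s p.2))
         (index_iota p.1.+1 p.2)]].

Definition stirling2 (n k : nat) : nat :=
  #|[set P : {set {set 'I_n}} | partition P [set: 'I_n] && (#|P| == k)]|.

Definition bell (n : nat) : nat := \sum_(0 <= k < n.+1) stirling2 n k.

Definition Psi (n t : nat) : nat := \sum_(0 <= k < t.+1) k ^ (n - 1).

Local Open Scope ring_scope.

Definition uniform_prob (R : realType) (T : finType) (A : {set T})
    (E : pred T) : R :=
  #|[set x in A | E x]|%:R / #|A|%:R.

Definition Theta (R : realType) (n t : nat) : R :=
  (expR 1)^-1 * \big[+%R/(0 : R)]_(t <= m <oo) (m%:R ^+ n / ((m - t)`!)%:R).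

Local Open Scope nat_scope.

Lemma entry_le s j : restricted_growth s -> j < size s -> entry s j.+1 <= j.+1.
Proof.
case/and3P=> _ /eqP s1 /allP sG; elim/ltn_ind: j => -[|j] IH lt_j.
  by rewrite s1.
have /sG/leq_trans: j.+1 \in index_iota 1 (size s) by rewrite mem_index_iota.
apply; rewrite add1n ltnS big_seq; elim/big_ind: _ => // [x y|k].
  by rewrite geq_max => -> ->.
rewrite mem_index_iota => /andP[]; case: k => // k _; rewrite !ltnS => le_kj.
by apply: leq_trans (IH k _ (leq_trans _ (ltnW lt_j))) _; rewrite ltnS // ltnW.
Qed.

Lemma rgsP n (s : seq nat) :
  (size s = n /\ restricted_growth s) <-> (exists2 p, p \in rgs n & entries p = s).
Proof.
split=> [[<- sG]|[p]]; last first.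
  by rewrite inE => pG <-; rewrite size_map size_tuple.
have tP : size [seq inord x : 'I_(size s).+1 | x <- s] == size s.
  by rewrite size_map.
have tE : entries (Tuple tP) = s.
  rewrite /entries /= -map_comp -[RHS]map_id; apply/eq_in_map => x /(nthP 0)[j].
  move=> lt_j <- /=; rewrite inordK // ltnS.
  by apply: leq_trans (entry_le sG lt_j) _.
by exists (Tuple tP); rewrite ?inE tE.
Qed.

(* Main.v *)
Require Import Defs.
From mathcomp Require Import all_boot all_order all_algebra.
From mathcomp Require Import reals topology normedtype sequences exp.
From mathcomp Require Import ring.
Import Order.TTheory GRing.Theory Num.Theory.
Import numFieldNormedType.Exports.

(** Cut a restricted growth sequence around the positions [i < j] into a prefix
of length [p = i - 1], the entry [v] at [i], a middle word of length
[k = j - i - 1], the entry [w] at [j], and a tail of length [q = n - j].  The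
entries that may follow a prefix depend on its maximum [t] only, so counting
reduces to three quantities.

- The number of prefixes with maximum [t] is [stirling2 p t]
  ([sum_foldl_max]): it satisfies the Stirling recurrence, because the last
  entry either repeats one of the [t] values already used or is a new maximum.
  With the trivial weight this also says that there are [bell n] sequences.
- The number of tails after maximum [t] is [Theta R q t]
  ([Theta_size_continuations]): on the series, the recurrence
  Theta (q + 1) t = t * Theta q t + Theta q (t + 1) comes from writing a factor
  m of the numerator as t + (m - t).
- Let [b = max t v].  A middle word makes [(i, j)] visible exactly when all its
  entries are below [minn v w].  Such entries are below [v <= b], so the word
  does not move the maximum: there are [(minn v w - 1) ^ k] of them, and [w]
  ranges over [1 .. b + 1] whatever the word is ([visible_completionsP]).

It remains to sum over [v] and [w].  For [w <= v] the powers add up to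
[Psi k.+1 (v - 1)], the [b - v] values of [w] in [v + 1 .. b] each give
[(v - 1) ^ k], and [w = b + 1] gives [(v - 1) ^ k] with the maximum raised to
[b + 1].  The recurrence for Theta absorbs the last contribution into
[Theta (q + 1) b], leaving the correction [- v (v - 1) ^ k]
([visible_completionsE]).  The values [v <= t] produce the two sums of the
formula that involve Theta at [t], and [v = t + 1] the two that involve Theta
at [t + 1]. *)

Local Open Scope nat_scope.

(** * Set partitions and the Stirling recurrence *)

Fixpoint stirling2_rec (n k : nat) : nat :=
  match n, k with
  | 0, 0 => 1
  | 0, _.+1 => 0
  | _.+1, 0 => 0
  | n'.+1, k'.+1 => stirling2_rec n' k' + k'.+1 * stirling2_rec n' k'.+1
  end.

Definition partitions_of {T : finType} (A : {set T}) (k : nat) :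
  {set {set {set T}}} :=
  [set P : {set {set T}} | partition P A && (#|P| == k)].

Lemma card_eq_of_cancel (aT rT : finType) (X : {set aT}) (Y : {set rT})
    (f : aT -> rT) (g : rT -> aT) :
  {in X, forall x, f x \in Y} -> {in Y, forall y, g y \in X} ->
  {in X, cancel f g} -> {in Y, cancel g f} -> #|X| = #|Y|.
Proof.
move=> fXY gYX fK gK; rewrite -(card_in_imset (can_in_inj fK)).
apply: eq_card => y; apply/imsetP/idP => [[x xX ->]|yY]; first exact: fXY.
by exists (g y); rewrite ?gYX ?gK.
Qed.

Section AddOnePoint.
Variables (T : finType) (A : {set T}) (x : T).
Hypothesis xA : x \notin A.

(** Adding and removing the block [[set x]] are inverse to each other. *)
Lemma card_partitions_singleton k :
  #|[set P in partitions_of (x |: A) k.+1 | [set x] \in P]|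
    = #|partitions_of A k|.
Proof.
apply: (@card_eq_of_cancel _ _ _ _ (fun P : {set {set T}} => P :\ [set x])
                             (fun Q : {set {set T}} => [set x] |: Q)).
- move=> P; rewrite !inE => /andP[/andP[PA /eqP cP] xP].
  have := partitionD1 PA xP; rewrite setU1K // => -> /=.
  by move: cP; rewrite (cardsD1 [set x]) xP add1n => -[->].
- move=> Q; rewrite !inE eqxx => /andP[QA /eqP cQ]; rewrite andbT.
  have x0 : [set x] != set0 by apply/set0Pn; exists x; rewrite inE.
  rewrite (partitionU1 QA x0) ?disjoints1 // cardsU1 cQ.
  suff -> : [set x] \notin Q by rewrite add1n eqxx.
  apply: contra xA => xQ; move: (partitionS QA xQ).
  by rewrite sub1set.
- by move=> P; rewrite !inE => /andP[_ xP]; rewrite setD1K.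
- move=> Q; rewrite inE => /andP[QA _]; rewrite setU1K //.
  apply: contra xA => xQ; move: (partitionS QA xQ).
  by rewrite sub1set.
Qed.

Lemma card_pointed_partitions k :
  #|[set QB : {set {set T}} * {set T} |
       (QB.1 \in partitions_of A k) && (QB.2 \in QB.1)]|
    = k * #|partitions_of A k|.
Proof.
rewrite -sum1dep_card.
rewrite -(pair_big_dep (fun Q => Q \in partitions_of A k) (fun Q B => B \in Q)
            (fun _ _ => 1)) /=.
rewrite (eq_bigr (fun=> k)) ?sum_nat_const 1?mulnC //.
by move=> Q; rewrite inE => /andP[_ /eqP <-]; rewrite sum1_card.
Qed.

(** Removing [x] from its block, while remembering which block it was,
is inverse to adding [x] to the marked block of a pointed partition.  The
hypothesis that [[set x]] is not a block keeps the remaining block nonempty. *)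
Lemma card_partitions_nonsingleton k :
  #|[set P in partitions_of (x |: A) k | [set x] \notin P]|
    = k * #|partitions_of A k|.
Proof.
rewrite -card_pointed_partitions.
pose add (QB : {set {set T}} * {set T}) := (x |: QB.2) |: (QB.1 :\ QB.2).
pose del (P : {set {set T}}) :=
  let B := pblock P x in ((B :\ x) |: (P :\ B), B :\ x).
(* The shrunken block is not already a block of [P], so [del] keeps the number
   of blocks. *)
have delP (P : {set {set T}}) :
   P \in partitions_of (x |: A) k -> [set x] \notin P ->
   [/\ pblock P x \in P, x \in pblock P x, pblock P x :\ x != set0,
       pblock P x :\ x \notin P & partition (del P).1 A].
  rewrite inE => /andP[PA cP] nxP.
  have xcov : x \in cover P by rewrite (cover_partition PA) setU11.
  have bP : pblock P x \in P by rewrite pblock_mem.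
  have xb : x \in pblock P x by rewrite mem_pblock.
  have nb0 : pblock P x :\ x != set0.
    apply: contra nxP => /eqP b0; suff -> : [set x] = pblock P x by [].
    by rewrite -(setD1K xb) b0 setU0.
  have tP := partition_trivIset PA.
  have nbP : pblock P x :\ x \notin P.
    apply/negP => b'P; case/set0Pn: (nb0) => y yb'.
    have yb : y \in pblock P x by case/setD1P: yb'.
    have := def_pblock tP b'P yb'; rewrite (def_pblock tP bP yb) => bb'.
    by move: xb; rewrite bb' !inE eqxx.
  split=> //=; have := partitionD1 PA bP => PDA.
  have -> : A = (pblock P x :\ x) :|: ((x |: A) :\: pblock P x).
    have sb := partitionS PA bP.
    apply/setP => y; rewrite !inE; have := subsetP sb y; rewrite !inE.
    case: (eqVneq y x) => [->|_] /=; first by rewrite xb (negbTE xA).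
    by case: (y \in pblock P x) => //= -> .
  apply: partitionU1 => //; rewrite disjoints_subset; apply/subsetP => y.
  by rewrite !inE => /andP[_ ->].
have addP (QB : {set {set T}} * {set T}) : QB.1 \in partitions_of A k ->
    QB.2 \in QB.1 -> [/\ partition (add QB) (x |: A), x |: QB.2 \notin QB.1,
    pblock (add QB) x = x |: QB.2 & x \notin QB.2].
  case: QB => Q B /=; rewrite inE => /andP[QA cQ] BQ.
  have sBA := partitionS QA BQ.
  have nxB : x \notin B by apply: contra xA; apply: (subsetP sBA).
  have PA : partition (add (Q, B)) (x |: A).
    have -> : x |: A = (x |: B) :|: (A :\: B).
      apply/setP => y; rewrite !inE; have := subsetP sBA y; case: (y == x) => //=.
      by case: (y \in B) => //= ->.
    apply: partitionU1; first exact: partitionD1.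
      by apply/set0Pn; exists x; rewrite setU11.
    rewrite disjoints_subset; apply/subsetP => y; rewrite !inE.
    by case/predU1P => [->|->] //; rewrite (negbTE xA) andbF.
  split=> //.
    apply: contra xA => xBQ; apply: (subsetP (partitionS QA xBQ)).
    exact: setU11.
  by apply: (def_pblock (partition_trivIset PA)); rewrite ?setU11.
apply: (@card_eq_of_cancel _ _ _ _ del add).
- move=> P; rewrite inE => /andP[Pk nxP].
  have [bP xb nb0 nbP PA] := delP P Pk nxP.
  rewrite !inE PA eqxx /= andbT cardsU1 !inE (negbTE nbP) andbF /=.
  by move: Pk; rewrite inE (cardsD1 (pblock P x)) bP => /andP[_].
- move=> QB; rewrite inE => /andP[Qk BQ].
  have [PA nQ _ nxB] := addP QB Qk BQ.
  rewrite !inE PA /= cardsU1 !inE (negbTE nQ) andbF /=.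
  have cQ : #|QB.1| == k by move: Qk; rewrite inE => /andP[].
  rewrite (cardsD1 QB.2) BQ in cQ; rewrite cQ /= negb_or negb_and.
  move: Qk; rewrite inE => /andP[QA _]; apply/andP; split.
    apply: contra (partition_neq0 QA BQ) => /eqP/setP xE.
    apply/eqP/setP => y; have := xE y; rewrite !inE.
    by case: (eqVneq y x) => [->|_] /=; rewrite ?(negbTE nxB).
  apply/orP; right; apply: contra xA => xQ; apply: (subsetP (partitionS QA xQ)).
  by rewrite inE.
- move=> P; rewrite inE => /andP[Pk nxP].
  have [bP xb nb0 nbP PA] := delP P Pk nxP.
  rewrite /add /= setU1K ?setD1K //.
  by rewrite !inE (negbTE nbP) andbF.
- move=> [Q B]; rewrite inE => /andP[Qk BQ].
  have [PA nQ /= bE nxB] := addP (Q, B) Qk BQ.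
  rewrite /del bE /= setU1K // /add /= setU1K ?setD1K //.
  by rewrite !inE (negbTE nQ) andbF.
Qed.

Lemma card_partitionsU1 k :
  #|partitions_of (x |: A) k.+1|
    = #|partitions_of A k| + k.+1 * #|partitions_of A k.+1|.
Proof.
rewrite -card_partitions_singleton -card_partitions_nonsingleton.
rewrite -[LHS](cardsID [set P : {set {set T}} | [set x] \in P]).
by congr (_ + _); apply: eq_card => P; rewrite !inE // andbC.
Qed.

End AddOnePoint.

(** Stated for subsets of an arbitrary finite type, so that the induction
can delete a point without renumbering ['I_n]. *)
Lemma card_partitions (T : finType) (A : {set T}) k :
  #|partitions_of A k| = stirling2_rec #|A| k.
Proof.
elim: {A}#|A| {-2}A (erefl #|A|) k => [|n IH] A cA k.
  move/eqP: cA; rewrite cards_eq0 => /eqP ->.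
  rewrite cards0 (_ : partitions_of set0 k = if k == 0 then [set set0] else set0).
    by case: k => [|k] /=; rewrite ?cards1 ?cards0.
  apply/setP => P; rewrite !inE partition_set0.
  by case: k => [|k]; rewrite !inE; case: eqP => // ->; rewrite cards0.
have /card_gt0P [x xA] : 0 < #|A| by rewrite cA.
have cA' : #|A :\ x| = n by move: cA; rewrite (cardsD1 x) xA => -[].
rewrite cA; case: k => [|k] /=.
  apply/eqP; rewrite cards_eq0 -subset0; apply/subsetP => P.
  rewrite !inE cards_eq0 => /andP[PA /eqP P0].
  by move: xA; rewrite -(cover_partition PA) P0 /cover big_set0 inE.
by rewrite -{1}(setD1K xA) card_partitionsU1 ?setD11 // !IH // cA'.
Qed.

Lemma stirling2E n k : stirling2 n k = stirling2_rec n k.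
Proof. by rewrite -[n in RHS]card_ord -cardsT -card_partitions. Qed.

(** * Restricted growth sequences as lists of continuations *)

(** The words of length [n] that can follow a restricted growth sequence
with maximum [m]; the restricted growth sequences themselves are the case
[m = 0], which forces the first entry to be 1. *)
Fixpoint continuations (m n : nat) : seq (seq nat) :=
  if n is n'.+1 then
    [seq a :: s | a <- index_iota 1 m.+2, s <- continuations (maxn m a) n']
  else [:: [::]].

Lemma continuationsS m n :
  continuations m n.+1 =
    [seq a :: s | a <- index_iota 1 m.+2, s <- continuations (maxn m a) n].
Proof. by []. Qed.

(** Splits off the first letter: one of the [m] old values, which keeps the
maximum, or the new maximum [m.+1]. *)
Lemma big_continuationsS (R : Type) (idx : R) (op : Monoid.law idx) m n F :
  \big[op/idx]_(s <- continuations m n.+1) F s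
    = op (\big[op/idx]_(1 <= a < m.+1)
            \big[op/idx]_(s <- continuations m n) F (a :: s))
         (\big[op/idx]_(s <- continuations m.+1 n) F (m.+1 :: s)).
Proof.
rewrite continuationsS big_allpairs_dep big_nat_recr //=; congr (op _ _).
  by apply: eq_big_nat => a /andP[_]; rewrite ltnS => /maxn_idPl ->.
by rewrite (maxn_idPr (leqnSn m)).
Qed.

Lemma size_continuationsS m n :
  size (continuations m n.+1)
    = m * size (continuations m n) + size (continuations m.+1 n).
Proof.
rewrite -!sum1_size big_continuationsS /= sum_nat_const_nat subSS subn0.
by [].
Qed.

Fixpoint grows (m : nat) (s : seq nat) : bool :=
  if s is a :: s' then (0 < a <= m.+1) && grows (maxn m a) s' else true.

Lemma mem_continuations m n s :
  (s \in continuations m n) = (size s == n) && grows m s.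
Proof.
elim: n m s => [|n IH] m s.
  by rewrite inE -size_eq0; case: s.
rewrite continuationsS; apply/allpairsPdep/idP.
  case=> a [s' [aR s'C ->]] /=.
  by move: aR s'C; rewrite mem_index_iota IH eqSS => -> /andP[-> ->].
case: s => [|a s'] //=; rewrite eqSS => /andP[ss' /andP[aR gs']].
by exists a, s'; rewrite mem_index_iota IH ss' aR.
Qed.

Lemma uniq_continuations m n : uniq (continuations m n).
Proof.
elim: n m => [|n IH] m //; rewrite continuationsS.
apply: allpairs_uniq_dep; first exact: iota_uniq.
  by move=> a _; apply: IH.
by case=> [a s] [b u] _ _ /= [-> ->].
Qed.

(** Bridges the one-pass test [grows], which carries the running maximum,
and the definition of restricted growth by prefix maxima. *)
Lemma growsE m s :
  grows m s = all (fun x => 0 < x) s &&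
    all (fun l => nth 0 s l <= (maxn m (\max_(0 <= k < l) nth 0 s k)).+1)
        (iota 0 (size s)).
Proof.
elim: s m => [|a s IH] m //=.
rewrite IH big_geq // maxn0 -!andbA; congr (_ && _).
rewrite andbCA; congr [&& _, _ & _].
rewrite (iotaDl 1 0) all_map; apply: eq_all => l /=.
by rewrite add1n big_nat_recl //= maxnA.
Qed.

Lemma restricted_growthE s : 0 < size s -> restricted_growth s = grows 0 s.
Proof.
case: s => [|a s] // _; rewrite growsE /restricted_growth /entry /=.
rewrite -!andbA; case a_gt0: (0 < a) => //=.
rewrite big_geq // maxn0 eqn_leq a_gt0 andbT.
congr (_ && (_ && _)).
rewrite /index_iota subn1 /=.
apply: eq_in_all => l; rewrite mem_iota => /andP[l_gt0 _].
by rewrite add1n max0n big_add1.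
Qed.

(** Transfers counting over tuples to counting in a duplicate-free list that
has a recursive structure. *)
Lemma card_rgs n (P : pred (seq nat)) : 0 < n ->
  #|[set p in rgs n | P (entries p)]| = count P (continuations 0 n).
Proof.
move=> n_gt0; have /permP/(_ P) <- : perm_eq [seq entries p | p <- enum (rgs n)]
    (continuations 0 n).
  apply: uniq_perm; last 1 first.
  - move=> s; rewrite mem_continuations; apply/mapP/andP.
      case=> p; rewrite mem_enum => pR ->.
      have [sz rg] : size (entries p) = n /\ restricted_growth (entries p).
        by apply/rgsP; exists p.
      by rewrite -restricted_growthE sz // n_gt0.
    case=> /eqP sz gs; have /rgsP[p pR <-] : size s = n /\ restricted_growth s.
      by rewrite restricted_growthE sz.
    by exists p; rewrite ?mem_enum.
  - rewrite map_inj_uniq ?enum_uniq // => p p' /(inj_map val_inj).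
    exact: val_inj.
  - exact: uniq_continuations.
by rewrite count_map -sum1_count big_enum_cond sum1dep_card.
Qed.

(** A prefix [s] influences what follows only through its maximum. *)
Lemma sum_continuations_cat m p q (F : seq nat -> nat) :
  \sum_(s <- continuations m (p + q)) F s
    = \sum_(s <- continuations m p)
        \sum_(u <- continuations (foldl maxn m s) q) F (s ++ u).
Proof.
elim: p m F => [|p IH] m F; first by rewrite big_seq1.
rewrite addSn !continuationsS !big_allpairs_dep.
by apply: eq_bigr => a _; rewrite IH.
Qed.

(** * Prefixes with a given maximum *)

Lemma stirling2_rec_gt n k : n < k -> stirling2_rec n k = 0.
Proof.
elim: n k => [|n IH] [|k] //=; rewrite ltnS => nk.
by rewrite !IH ?muln0 // ltnW.
Qed.

(** With an arbitrary weight [g] of the maximum the induction on the length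
closes: appending one letter replaces [g t] by [t * g t + g t.+1], which is dual
to the Stirling recurrence. *)
Lemma sum_foldl_max p (g : nat -> nat) :
  \sum_(s <- continuations 0 p) g (foldl maxn 0 s)
    = \sum_(0 <= t < p.+1) stirling2 p t * g t.
Proof.
under [RHS]eq_bigr do rewrite stirling2E.
elim: p g => [|p IH] g; first by rewrite big_seq1 big_nat1 mul1n.
rewrite -addn1 sum_continuations_cat.
under eq_bigr => s _.
  rewrite big_continuationsS /= big_seq1 foldl_cat /= (maxn_idPr (leqnSn _)).
  rewrite (eq_big_nat _ _ (F2 := fun=> g (foldl maxn 0 s))); last first.
    move=> a /andP[_]; rewrite ltnS big_seq1 foldl_cat /=.
    by move/maxn_idPl ->.
  rewrite sum_nat_const_nat subn1 /=.
  over.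
rewrite (IH (fun t => t * g t + g t.+1)).
rewrite addn1 [RHS]big_nat_recl //= mul0n add0n.
under eq_bigr do rewrite mulnDr addnC.
under [RHS]eq_bigr do rewrite mulnDl.
rewrite !big_split /=; congr (_ + _).
rewrite big_nat_recl // mul0n muln0 add0n.
rewrite [RHS]big_nat_recr //= stirling2_rec_gt // muln0 mul0n addn0.
by apply: eq_bigr => t _; rewrite mulnCA mulnA.
Qed.

Lemma bellE n : bell n = size (continuations 0 n).
Proof.
rewrite -sum1_size (sum_foldl_max n (fun=> 1)).
by apply: eq_bigr => k _; rewrite muln1.
Qed.

(** * Completions that keep a pair visible *)

Lemma foldl_maxn_id m s : all (fun x => x <= m) s -> foldl maxn m s = m.
Proof. by elim: s => [|a s IH] //= /andP[/maxn_idPl -> /IH]. Qed.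

(** Letters below [c <= m.+1] never raise the maximum [m], so they can be
chosen independently among [1 .. c - 1]. *)
Lemma count_continuations_below m k c : c <= m.+1 ->
  \sum_(s <- continuations m k) all (fun x => x < c) s = c.-1 ^ k.
Proof.
move=> lecm; elim: k => [|k IH]; first by rewrite big_seq1.
rewrite big_continuationsS /= [X in _ + X]big1 ?addn0; last first.
  by move=> s _; rewrite ltnNge lecm.
rewrite expnS -IH -[X in _ = X * _]subn1 -[X in _ = X * _]muln1.
rewrite -sum_nat_const_nat.
rewrite (big_nat_widen _ _ _ _ _ lecm) [in RHS]big_mkcond /= big_distrl /=.
apply: eq_bigr => a _; case: (a < c); last by rewrite mul0n big1.
by rewrite mul1n.
Qed.

Lemma mem_strong_visible_cat p k s v t w u : size s = p -> size t = k ->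
  ((p.+1, p + k + 2) \in strong_visible (s ++ v :: t ++ w :: u))
    = all (fun x => x < minn v w) t.
Proof.
move=> sp tk; rewrite inE /= /entry !size_cat /= !size_cat /= sp tk.
have -> : p.+1 < p + k + 2 by rewrite addn2 !ltnS leq_addr.
have -> : p + k + 2 <= p + (k + (size u).+1).+1.
  by rewrite addn2 !addnS !ltnS addnA leq_addr.
rewrite !addn2 /= nth_cat sp ltnn subnn /=.
rewrite nth_cat sp ltnNge -addnS leq_addr /= addKn /= nth_cat tk ltnn subnn /=.
apply/allP/(all_nthP 0) => [vis l | vis l].
  rewrite tk => lk; have := vis (p + l).+2.
  rewrite mem_index_iota !ltnS leq_addr -addnS ltn_add2l ltnS lk => /(_ isT) /=.
  by rewrite nth_cat sp [_ < p]ltnNge leq_addr /= addKn /= nth_cat tk lk.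
rewrite mem_index_iota; case: l => [|[|l]] //; rewrite !ltnS => /andP[pl lt].
have lk : l - p < k by rewrite ltn_subLR // -ltnS -addnS.
have := vis (l - p); rewrite tk => /(_ lk).
by rewrite /= nth_cat sp [_ < p]ltnNge leqW //= subSn //= nth_cat tk lk.
Qed.

(** When the entry [v] at position [i] leaves the maximum at [b], this counts
the ways to complete the sequence so that the pair is visible; [w] is the second
endpoint, [k] the number of letters in between and [q] the length of the
tail. *)
Definition visible_completions (k q b v : nat) : nat :=
  \sum_(1 <= w < b.+2) (minn v w).-1 ^ k * size (continuations (maxn b w) q).

(** In the sum on the left the range of [w] depends on the middle word [s]
through its maximum.  A nonzero term has all of [s] below [v <= b], so that the
maximum is still [b]; then the sums over [s] and [w] can be exchanged. *)
Lemma visible_completionsP k q b v : v <= b ->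
  \sum_(s <- continuations b k)
    \sum_(u <- continuations (foldl maxn b s) q.+1)
      all (fun x => x < minn v (head 0 u)) s = visible_completions k q b v.
Proof.
move=> vb.
transitivity (\sum_(s <- continuations b k) \sum_(1 <= w < b.+2)
   all (fun x => x < minn v w) s * size (continuations (maxn b w) q)).
  apply: eq_bigr => s _; rewrite continuationsS big_allpairs_dep /=.
  have [sv|nsv] := boolP (all (fun x => x < v) s).
    rewrite foldl_maxn_id; last first.
      by apply: sub_all sv => x xv; apply: ltnW (leq_trans xv vb).
    apply: eq_bigr => w _; rewrite -sum1_size big_distrr /=.
    by apply: eq_bigr => u _; rewrite muln1.
  have nmin w : all (fun x => x < minn v w) s = false.
    apply: contraNF nsv; apply: sub_all => x xv.
    by apply: leq_trans xv (geq_minl _ _).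
  rewrite !big1 // => w _; rewrite ?nmin //.
  by rewrite big1 // => u _; rewrite nmin.
rewrite exchange_big; apply: eq_bigr => w _ /=.
rewrite -big_distrl /= count_continuations_below //.
by apply: leqW; apply: leq_trans (geq_minl _ _) vb.
Qed.

Lemma count_strong_visible p k q :
  count (fun s => (p.+1, p + k + 2) \in strong_visible s)
        (continuations 0 (p + (k + q.+1).+1))
    = \sum_(0 <= t < p.+1) stirling2 p t *
        (\sum_(1 <= v < t.+1) visible_completions k q t v
         + visible_completions k q t.+1 t.+1).
Proof.
rewrite -sum_foldl_max -sum1_count big_mkcond /= sum_continuations_cat.
apply: eq_big_seq => s; rewrite mem_continuations => /andP[/eqP sp _].
set m := foldl maxn 0 s.
(* Used with [b = m] when [v] is an old value and with [b = m.+1] when [v] is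
   the new maximum. *)
have step b v : v <= b ->
  \sum_(z <- continuations b (k + q.+1))
     (if (p.+1, p + k + 2) \in strong_visible (s ++ v :: z) then 1 else 0)
    = visible_completions k q b v.
  move=> vb; rewrite sum_continuations_cat -visible_completionsP //.
  apply: eq_big_seq => t; rewrite mem_continuations => /andP[/eqP tk _].
  apply: eq_big_seq => -[|w u]; rewrite mem_continuations // => _.
  by rewrite mem_strong_visible_cat //=; case: all.
rewrite big_continuationsS step //; congr (_ + _).
by apply: eq_big_nat => v /andP[_ vm]; exact: (step m v vm).
Qed.

(** Evaluates the sum over [w], cut at [w = v] and [w = b].  The negative
correction is moved to the left to stay in [nat]: the recurrence
[size_continuationsS] applied to the tails of length [q.+1] provides [b] copies
of the tails of length [q], of which only [b - v] are available. *)
Lemma visible_completionsE k q b v : 0 < v <= b ->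
  visible_completions k q b v + v * v.-1 ^ k * size (continuations b q)
   = Psi k.+1 v.-1 * size (continuations b q)
     + v.-1 ^ k * size (continuations b q.+1).
Proof.
move=> /andP[v0 vb]; rewrite /visible_completions big_nat_recr //=.
rewrite (maxn_idPr (leqnSn b)) (minn_idPl (leqW vb)).
rewrite (@big_cat_nat _ _ _ v.+1) //=.
have -> : \sum_(1 <= w < v.+1) (minn v w).-1 ^ k *
     size (continuations (maxn b w) q)
   = Psi k.+1 v.-1 * size (continuations b q).
  rewrite /Psi prednK // subSS subn0 big_add1 /= big_distrl /=.
  apply: eq_big_nat => w /andP[_ wv].
  by rewrite (minn_idPr wv) (maxn_idPl (leq_trans wv vb)).
have -> : \sum_(v.+1 <= w < b.+1) (minn v w).-1 ^ k *
     size (continuations (maxn b w) q)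
   = (b - v) * (v.-1 ^ k * size (continuations b q)).
  rewrite -[b - v]subSS -sum_nat_const_nat.
  apply: eq_big_nat => w /andP[vw]; rewrite ltnS => wb.
  by rewrite (minn_idPl (ltnW vw)) (maxn_idPl wb).
rewrite size_continuationsS mulnDr -!addnA; congr (_ + _).
rewrite addnCA [RHS]addnC; congr (_ + _).
by rewrite -mulnA -mulnDl subnK // mulnCA.
Qed.

(** * The Dobinski-type series counts continuations *)

Local Open Scope classical_set_scope.
Local Open Scope ring_scope.

(** Convergence and value are obtained together by induction on [n]: writing
m ^ (n + 1) = (t + (m - t)) m ^ n and cancelling [m - t] with the factorial
turns a partial sum for [n.+1] at [t] into partial sums, with the same upper
bound, for [n] at [t] and at [t.+1].  This is the recurrence of
[size_continuationsS]. *)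
Lemma cvg_Theta_sum (R : realType) n t :
  (fun N => \sum_(t <= m < N) (m%:R ^+ n / ((m - t)`!)%:R) : R) @ \oo
    --> ((size (continuations t n))%:R * expR 1 : R).
Proof.
elim: n t => [|n IH] t.
  rewrite mul1r -(cvg_shiftn t) /=.
  rewrite (_ : (fun N => _) = series (exp_coeff (1 : R))); first
    exact: is_cvg_series_exp_coeff.
  apply/boolp.funext => N; rewrite /series /= -{1}[t]add0n big_addn addnK.
  by apply: eq_bigr => m _; rewrite addnK expr0 /exp_coeff /= expr1n.
rewrite size_continuationsS natrD natrM mulrDl -mulrA.
pose P k N : R := \sum_(k <= m < N) (m%:R ^+ n / ((m - k)`!)%:R).
rewrite (_ : (fun N => _) = (fun N => t%:R * P t N + P t.+1 N)).
  by apply: cvgD; [apply: cvgMl_tmp; apply: IH | apply: IH].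
apply/boolp.funext => N; rewrite /P.
(* The term m = t vanishes in the second sum, hence its lower bound t + 1. *)
have [leNt|ltNt] := leqP N t.
  by rewrite !big_geq // ?mulr0 ?addr0 // leqW.
rewrite mulr_sumr [in RHS]big_ltn // [in LHS]big_ltn // -addrA -big_split /=.
congr (_ + _); first by rewrite exprS mulrA.
apply: eq_big_nat => m /andP[ltm _].
have -> : (m - t = (m - t.+1).+1)%N by rewrite subnSK.
rewrite factS natrM invfM exprS.
rewrite {1}(_ : m = t + (m - t.+1).+1)%N; last
  by rewrite addnS -addSn subnKC.
rewrite natrD !mulrDl -!mulrA; congr (_ + _).
by rewrite mulrCA mulVKf // pnatr_eq0.
Qed.

Lemma Theta_size_continuations (R : realType) n t :
  Theta R n t = (size (continuations t n))%:R.
Proof.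
have /cvg_lim limE := @cvg_Theta_sum R n t.
rewrite /Theta limE //.
by rewrite mulrC mulfK // gt_eqF // expR_gt0.
Qed.

(** * The visibility probability *)

Lemma visible_completionsR (R : realType) k q b v : (0 < v <= b)%N ->
  (visible_completions k q b v)%:R =
    Theta R q b * (- (v%:R * (v%:R - 1) ^+ k) + (Psi k.+1 v.-1)%:R)
    + Theta R q.+1 b * (v%:R - 1) ^+ k.
Proof.
move=> vb; have v0 : (0 < v)%N by case/andP: vb.
have /(congr1 (fun x : nat => x%:R : R)) := visible_completionsE k q b v vb.
rewrite /= !natrD !natrM natrX -subn1 natrB // !Theta_size_continuations.
by move/(canRL (addrK _)) ->; ring.
Qed.

Lemma sum_powers_Psi (R : realType) k t : (0 < t)%N ->
  \sum_(1 <= v < t.+1) (v%:R - 1) ^+ k = (Psi k.+1 t.-1)%:R :> R.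
Proof.
move=> t0; rewrite /Psi prednK // big_add1 /= natr_sum.
by apply: eq_bigr => v _; rewrite -natr1 addrK natrX subn1.
Qed.

Theorem theorem4 (R : realType) (n i j : nat) (hn : (3 <= n)%N)
    (hi : (2 <= i)%N) (hij : (i < j)%N) (hjn : (j <= n)%N)
    (hgap : (i + 1 < j)%N) :
  (bell n)%:R *
    uniform_prob R (rgs n) (fun p => (i, j) \in strong_visible (entries p)) =
  \sum_(1 <= t < i)
     (stirling2 (i - 1) t)%:R * Theta R (n - j + 1) t
       * (Psi (j - i) (t - 1))%:R
  + \sum_(1 <= t < i)
     (stirling2 (i - 1) t)%:R * Theta R (n - j) t
       * (\sum_(1 <= a < t.+1)
            (- (a%:R * (a%:R - 1) ^+ (j - i - 1)) + (Psi (j - i) (a - 1))%:R))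
  + \sum_(1 <= t < i)
     (stirling2 (i - 1) t)%:R * Theta R (n - j + 1) (t + 1)
       * t%:R ^+ (j - i - 1)
  + \sum_(1 <= t < i)
     (stirling2 (i - 1) t)%:R * Theta R (n - j) (t + 1)
       * (- ((t%:R + 1) * t%:R ^+ (j - i - 1)) + (Psi (j - i) t)%:R).
Proof.
have n0 : (0 < n)%N by apply: leq_trans hn.
have rgs_bell : #|rgs n| = bell n.
  rewrite bellE -count_predT -card_rgs //.
  by apply: eq_card => p; rewrite !inE andbT.
(* [1 :: s] is a sequence of length [n] for every [s] that can follow [1]. *)
have bell0 : (bell n)%:R != 0 :> R.
  rewrite pnatr_eq0 bellE -lt0n; have := size_continuationsS 0 n.-1.
  rewrite prednK // => ->; rewrite mul0n add0n {hn hjn n0 rgs_bell}.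
  elim: n.-1 {2}1%N => [|m IH] b //.
  by rewrite size_continuationsS ltn_addl.
rewrite /uniform_prob rgs_bell mulrC divfK //.
rewrite (card_rgs _ (fun s => (i, j) \in strong_visible s)) //.
pose p := (i - 1)%N; pose k := (j - i - 1)%N; pose q := (n - j)%N.
have Ei : i = p.+1 by rewrite /p subn1 prednK // ltnW.
have Ek : (j - i)%N = k.+1 by rewrite /k subn1 prednK // subn_gt0.
have Ej : j = (p + k + 2)%N.
  by rewrite -[LHS](subnKC (ltnW hij)) Ek {1}Ei addnS addSn addn2.
have En : n = (p + (k + q.+1).+1)%N.
  by rewrite -[LHS](subnK hjn) -/q Ej addnC addn2 !addnS addnA.
rewrite -/k -/q -/p Ek.
have -> : count (fun s => (i, j) \in strong_visible s) (continuations 0 n)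
  = count (fun s => (p.+1, p + k + 2)%N \in strong_visible s)
      (continuations 0 (p + (k + q.+1).+1)) by rewrite -Ei -Ej -En.
rewrite count_strong_visible big_ltn //.
have -> : stirling2 p 0 = 0%N by rewrite stirling2E /p; case: (i) hi => [|[|i']].
(* The term t = 0 is zero because the prefix is nonempty. *)
rewrite mul0n add0n natr_sum -Ei -!big_split /=.
apply: eq_big_nat => t /andP[t0 _].
rewrite natrM natrD natr_sum (eq_big_nat _ _ (F2 := fun v =>
  Theta R q t * (- (v%:R * (v%:R - 1) ^+ k) + (Psi k.+1 (v - 1))%:R)
   + Theta R q.+1 t * (v%:R - 1) ^+ k)); last first.
  by move=> v /andP[v0 vt]; rewrite visible_completionsR ?subn1 // v0.
rewrite big_split /= -!mulr_sumr sum_powers_Psi // visible_completionsR ?ltnSn //.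
rewrite !addn1 subn1 -natr1 addrK /=; ring.
Qed.
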